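(* Let $G$ be an infinite group and $A\subseteq G$. Then: (i) for $n\in\mathbb{N}$, $A$ is not $n$-thin if and only if there exist a subset $F\subseteq G$ with $|F|=n+1$ and an injective sequence $(x_k)_{k<\omega}$ in $G$ such that $Fx_k\subseteq A$ for every $k\in\omega$; (ii) $A$ is not sparse if and only if there exist injective sequences $(x_n)_{n<\omega}$, $(y_n)_{n<\omega}$ in $G$ with $x_ny_m\in A$ for all $0\le n\le m<\omega$; (iii) $A$ is not scattered if and only if $A$ contains a piecewise shifted $FP$-set; (iv) $A$ contains a recurrent subset if and only if there exist $x\in A$ and an $FP$-set $Y$ with $xY\subseteq A$.
   Context: $A$ is $n$-thin if for all distinct $g_0,\dots,g_n\in G$ the set $g_0A\cap\dots\cap g_nA$ is finite. $A$ is sparse if for every infinite $X\subseteq G$ there is finite $F\subseteq X$ with $\bigcap_{g\in F}gA$ finite. Identify $\beta G$ with the ultrafilters on $G$ ($gp=\{gP:P\in p\}$), $G^*$ the free ultrafilters, $X^*=\{p\in G^*:X\in p\}$, $\Delta_p(X)=\{gp:g\in G, X\in gp\}$; $A$ is scattered if for every infinite $X\subseteq A$ there is $p\in X^*$ with $\Delta_p(X)$ finite. For an injective sequence $(g_n)_{n\in\omega}$ in $G$, the set $\{g_{i_1}g_{i_2}\cdots g_{i_k}: k\ge1, 0\le i_1<\dots<i_k<\omega\}$ is an $FP$-set; given additionally any sequence $(b_n)_{n\in\omega}$ in $G$, the set $\{g_{i_1}\cdots g_{i_k}b_{i_k}: k\ge1, 0\le i_1<\dots<i_k<\omega\}$ is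 a piecewise shifted $FP$-set. Identify $\mathcal{P}_G$ with $\{0,1\}^G$ (product topology) as a $G$-space via $(B,g)\mapsto Bg$; $B\subseteq G$ is recurrent if for every neighbourhood $U$ of $B$ in $\mathcal{P}_G$ the set $\{g\in G: Bg\in U\}$ is infinite.
   Formalization: In (iv) the recurrent subset is required to be nonempty: the empty set is trivially recurrent under the given definition, so (iv) as written fails, for example for A = ∅. *)

(* Defs.v *)
From Stdlib Require Import List Arith Sorted.
Import ListNotations.
Set Implicit Arguments.

Record Group := {
  carrier :> Type;
  gmul : carrier -> carrier -> carrier;
  gone : carrier;
  ginv : carrier -> carrier;
  gmul_assoc : forall x y z, gmul x (gmul y z) = gmul (gmul x y) z;
  gmul_1l : forall x, gmul gone x = x;
  gmul_1r : forall x, gmul x gone = x;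
  gmul_Vl : forall x, gmul (ginv x) x = gone;
  gmul_Vr : forall x, gmul x (ginv x) = gone
}.

Definition finite {T : Type} (X : T -> Prop) : Prop :=
  exists l : list T, forall x, X x -> In x l.

Definition injective_seq {T : Type} (x : nat -> T) : Prop :=
  forall i j, x i = x j -> i = j.

Section G.
Context {G : Group}.

Definition ltrans (g : G) (A : G -> Prop) : G -> Prop :=
  fun y => exists a, A a /\ y = gmul G g a.

Definition rtrans (B : G -> Prop) (g : G) : G -> Prop :=
  fun y => exists b, B b /\ y = gmul G b g.

Definition n_thin (n : nat) (A : G -> Prop) : Prop :=
  forall g : nat -> G,
    (forall i j, i <= n -> j <= n -> g i = g j -> i = j) ->
    finite (fun y => forall i, i <= n -> ltrans (g i) A y).

Definition sparse (A : G -> Prop) : Prop :=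
  forall X : G -> Prop, ~ finite X ->
    exists F : list G, (forall f, In f F -> X f) /\
      finite (fun y => forall f, In f F -> ltrans f A y).

Definition ultrafilter (p : (G -> Prop) -> Prop) : Prop :=
  ~ p (fun _ => False) /\
  (forall P Q, p P -> (forall x, P x -> Q x) -> p Q) /\
  (forall P Q, p P -> p Q -> p (fun x => P x /\ Q x)) /\
  (forall P, p P \/ p (fun x => ~ P x)).

Definition free_uf (p : (G -> Prop) -> Prop) : Prop :=
  forall P, p P -> ~ finite P.

Definition uf_act (g : G) (p : (G -> Prop) -> Prop) : (G -> Prop) -> Prop :=
  fun X => exists P, p P /\ X = ltrans g P.

Definition Delta (p : (G -> Prop) -> Prop) (X : G -> Prop)
  : ((G -> Prop) -> Prop) -> Prop :=
  fun q => exists g, q = uf_act g p /\ uf_act g p X.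

Definition scattered (A : G -> Prop) : Prop :=
  forall X : G -> Prop, (forall x, X x -> A x) -> ~ finite X ->
    exists p, ultrafilter p /\ free_uf p /\ p X /\ finite (Delta p X).

Definition gprod (l : list G) : G := fold_right (gmul G) (gone G) l.

Definition FPset (g : nat -> G) : G -> Prop :=
  fun y => exists s : list nat, s <> [] /\ Sorted lt s /\
    y = gprod (map g s).

Definition PSFPset (g : nat -> G) (b : nat -> G) : G -> Prop :=
  fun y => exists s : list nat, s <> [] /\ Sorted lt s /\
    y = gmul G (gprod (map g s)) (b (last s 0)).

(* neighbourhoods of B in P_G = {0,1}^G with the product topology:
   U contains a basic cylinder {C : C ∩ K = B ∩ K}, K finite *)
Definition nbhd (U : (G -> Prop) -> Prop) (B : G -> Prop) : Prop :=
  exists K : list G, forall C : G -> Prop,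
    (forall k, In k K -> (C k <-> B k)) -> U C.

Definition recurrent (B : G -> Prop) : Prop :=
  forall U, nbhd U B -> ~ finite (fun g => U (rtrans B g)).

End G.

(* Main.v *)
(* All four sequences are built by dependent choice. For a non-scattered A, let
   X ⊆ A be infinite with Delta_p(X) infinite for every free p containing X,
   and let I be maximal among the left-invariant ideals that contain the finite
   sets but not X. If Y ⊆ X is not in I, then Y ∩ g^-1 Y is not in I for
   infinitely many g; iterating gives an injective sequence (g_n) such that,
   for each n, some c_n satisfies s c_n ∈ X for all ordered products s of
   g_0, ..., g_(n-1), and b_n = g_n^-1 c_n yields the piecewise shifted FP-set.
   Conversely, if X is such a set, then for each m a free p containing X
   contains s X_m for some ordered product s of g_0, ..., g_(m-1), where X_m is
   built from the indices >= m; hence X belongs to each g_i s^-1 p with i < m,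
   and these are distinct because G acts freely on its ultrafilters. For (iv),
   {x} ∪ x FP(g) need not be recurrent, but it becomes so after passing to a
   subsequence of g avoiding finitely many accidental products at each step. *)
Require Import Defs.
From Stdlib Require Import List Arith Sorted.
From Stdlib Require Import Lia Classical ClassicalEpsilon.
From Stdlib Require Import FunctionalExtensionality PropExtensionality.
From mathcomp Require boolp classical_sets.
Import ListNotations.
Set Implicit Arguments.
Set Bullet Behavior "Strict Subproofs".

(** * Finite and infinite sets; sequences built by dependent choice *)

Lemma pred_ext {T : Type} (P Q : T -> Prop) : (forall x, P x <-> Q x) -> P = Q.
Proof.
intros H; extensionality x; apply propositional_extensionality, H.
Qed.

Lemma finite_subset {T : Type} (P Q : T -> Prop) :
  (forall x, P x -> Q x) -> finite Q -> finite P.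
Proof. intros H [l Hl]; exists l; auto. Qed.

Lemma finite_image {S T : Type} (f : S -> T) (P : S -> Prop) (Q : T -> Prop) :
  finite P -> (forall y, Q y -> exists x, P x /\ y = f x) -> finite Q.
Proof.
intros [l Hl] H; exists (map f l); intros y Hy.
destruct (H y Hy) as (x & Px & ->); apply in_map, Hl, Px.
Qed.

Lemma finite_union {T : Type} (P Q : T -> Prop) :
  finite P -> finite Q -> finite (fun x => P x \/ Q x).
Proof.
intros [l Hl] [l' Hl']; exists (l ++ l'); intros x [H | H]; apply in_or_app; auto.
Qed.

Lemma infinite_not_in {T : Type} (P : T -> Prop) (l : list T) :
  ~ finite P -> exists x, P x /\ ~ In x l.
Proof.
intros H; apply NNPP; intros H'; apply H; exists l; intros x Px.
apply NNPP; intros Hx; apply H'; exists x; auto.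
Qed.

(** Pigeonhole. The family [f] may change with [N], which serves when no single injective sequence
    in [P] is at hand. *)
Lemma infinite_of_arbitrarily_many {T : Type} (P : T -> Prop) :
  (forall N, exists f : nat -> T,
     (forall i j, i < N -> j < N -> f i = f j -> i = j) /\
     (forall i, i < N -> P (f i))) ->
  ~ finite P.
Proof.
intros H [l Hl]; destruct (H (S (length l))) as (f & Hinj & Hf).
assert (Hn : NoDup (map f (seq 0 (S (length l))))).
{ assert (Hs : forall i, In i (seq 0 (S (length l))) -> i < S (length l))
    by (intros i Hi; apply in_seq in Hi; lia).
  assert (Hd := seq_NoDup (S (length l)) 0).
  revert Hs Hd; generalize (seq 0 (S (length l))) as s.
  induction s as [|a s IH]; simpl; intros Hs Hd; constructor; inversion Hd; subst.
  - intros Ha; apply in_map_iff in Ha; destruct Ha as (j & Hj & Hjs).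
    apply Hinj in Hj; auto; subst; contradiction.
  - apply IH; auto. }
assert (Hle : length (map f (seq 0 (S (length l)))) <= length l).
{ apply NoDup_incl_length; trivial.
  intros y Hy; apply in_map_iff in Hy; destruct Hy as (i & <- & Hi).
  apply Hl, Hf; apply in_seq in Hi; lia. }
rewrite length_map, length_seq in Hle; lia.
Qed.

Lemma infinite_of_tail {T : Type} (P : T -> Prop) (x : nat -> T) (N : nat) :
  injective_seq x -> (forall n, N <= n -> P (x n)) -> ~ finite P.
Proof.
intros Hx HP; apply infinite_of_arbitrarily_many; intros M.
exists (fun i => x (N + i)); split.
- intros i j _ _ Hij; apply Hx in Hij; lia.
- intros i _; apply HP; lia.
Qed.

(** The newest entry comes first, so recursion on the list strips the largest index. *)
Fixpoint hist {T : Type} (x : nat -> T) (n : nat) : list T :=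
  match n with 0 => [] | S n => x n :: hist x n end.

Lemma in_hist {T : Type} (x : nat -> T) (n : nat) (t : T) :
  In t (hist x n) <-> exists i, i < n /\ t = x i.
Proof.
induction n as [|n IH]; simpl.
- split; [tauto | intros (i & Hi & _); lia].
- rewrite IH; split.
  + intros [<- | (i & Hi & ->)]; [exists n | exists i]; auto.
  + intros (i & Hi & ->); destruct (Nat.eq_dec i n) as [-> | Hn]; auto.
    right; exists i; split; auto; lia.
Qed.

Lemma map_hist {S T : Type} (f : S -> T) (x : nat -> S) (n : nat) :
  map f (hist x n) = hist (fun i => f (x i)) n.
Proof. induction n as [|n IH]; simpl; congruence. Qed.

Lemma injective_of_fresh {T : Type} (x : nat -> T) :
  (forall n, ~ In (x n) (hist x n)) -> injective_seq x.
Proof.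
intros H i j Hij; destruct (lt_eq_lt_dec i j) as [[Hl | He] | Hl]; trivial.
- destruct (H j); apply in_hist; exists i; auto.
- destruct (H i); apply in_hist; exists j; auto.
Qed.

Lemma dependent_choice {T : Type} (R : list T -> T -> Prop) :
  (forall l, exists t, R l t) -> exists x, forall n, R (hist x n) (x n).
Proof.
intros H.
set (f := fun l => proj1_sig (constructive_indefinite_description _ (H l))).
assert (Hf : forall l, R l (f l))
  by (intros l; exact (proj2_sig (constructive_indefinite_description _ (H l)))).
set (h := fix h n := match n with 0 => [] | S n => f (h n) :: h n end).
exists (fun n => f (h n)); intros n.
replace (hist (fun n => f (h n)) n) with (h n); [apply Hf |].
induction n as [|n IH]; simpl; congruence.
Qed.

Lemma dependent_choice_inv {T : Type} (Inv : list T -> Prop) :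
  Inv [] -> (forall l, Inv l -> exists t, ~ In t l /\ Inv (t :: l)) ->
  exists x, injective_seq x /\ forall n, Inv (hist x n).
Proof.
intros H0 HS; destruct (HS [] H0) as (t0 & _).
(* Guarding by [Inv l] makes the relation total; [t0] only serves histories that violate the
   invariant. *)
destruct (@dependent_choice T (fun l t => Inv l -> ~ In t l /\ Inv (t :: l)))
  as [x Hx].
{ intros l; destruct (classic (Inv l)) as [Hl | Hl].
  - destruct (HS l Hl) as [t Ht]; exists t; auto.
  - exists t0; tauto. }
assert (Hi : forall n, Inv (hist x n)).
{ induction n as [|n IH]; trivial; apply Hx, IH. }
exists x; split; trivial.
apply injective_of_fresh; intros n; apply Hx, Hi.
Qed.

Lemma injective_choice {T : Type} (R : nat -> T -> Prop) :
  (forall n, ~ finite (R n)) -> exists x, injective_seq x /\ forall n, R n (x n).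
Proof.
intros H.
(* [length l] recovers the index of the term being chosen. *)
destruct (@dependent_choice T (fun l t => R (length l) t /\ ~ In t l)) as [x Hx].
{ intros l; apply infinite_not_in, H. }
assert (Hl : forall n, length (hist x n) = n)
  by (induction n; simpl; congruence).
exists x; split.
- apply injective_of_fresh; intros n; apply Hx.
- intros n; destruct (Hx n) as [Hn _]; rewrite Hl in Hn; trivial.
Qed.

(** Zorn's lemma for inclusion, with [S0] bounding the empty chain. [M] need not contain [S0], so
    any lower bound wanted for [M] goes into [Phi]. *)
Lemma maximal_predicate {T : Type} (Phi : (T -> Prop) -> Prop) (S0 : T -> Prop) :
  Phi S0 ->
  (forall C : (T -> Prop) -> Prop,
     (forall S, C S -> Phi S) -> (exists S, C S) ->
     (forall S S', C S -> C S' ->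
        (forall x, S x -> S' x) \/ (forall x, S' x -> S x)) ->
     Phi (fun x => exists S, C S /\ S x)) ->
  exists M, Phi M /\
    forall N, Phi N -> (forall x, M x -> N x) -> forall x, N x -> M x.
Proof.
intros H0 Hchain.
pose (sub := fun S S' : {S | Phi S} =>
  forall x, proj1_sig S x -> proj1_sig S' x).
pose (R := fun S S' => boolp.asbool (sub S S')).
assert (HR : forall S S', is_true (R S S') <-> sub S S').
{ intros S S'; split; [apply boolp.asboolW | apply boolp.asboolT]. }
destruct (@classical_sets.Zorn _ R) as [M HM].
- intros S; apply HR; red; auto.
- intros S1 S2 S3 H1 H2; apply HR; apply HR in H1; apply HR in H2; red in H1, H2 |- *; auto.
- intros [S HS] [S' HS'] H1 H2; apply HR in H1; apply HR in H2.
  assert (S = S') as <- by (apply pred_ext; split; [apply H1 | apply H2]).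
  f_equal; apply proof_irrelevance.
- intros A HA; destruct (classic (exists S, A S)) as [[S1 HS1] | He].
  + pose (C := fun S => exists H : Phi S, A (exist _ S H)).
    assert (HC : Phi (fun x => exists S, C S /\ S x)).
    { apply Hchain.
      - intros S [HS _]; trivial.
      - destruct S1 as [S1 H1]; exists S1, H1; trivial.
      - intros S S' [HS AS] [HS' AS'].
        destruct (HA _ _ AS AS') as [H | H]; apply HR in H; auto. }
    exists (exist _ _ HC); intros [S HS] AS; apply HR; intros x Sx.
    exists S; split; trivial; exists HS; trivial.
  + exists (exist _ S0 H0); intros S AS; destruct He; exists S; trivial.
- destruct M as [M PM]; exists M; split; trivial.
  intros N PN HMN.
  assert (E : exist _ N PN = exist Phi M PM) by (apply HM, HR; exact HMN).
  injection E as ->; auto.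
Qed.

(** * Group laws, translates and the action on ultrafilters *)

Local Notation "x · y" := (gmul _ x y) (at level 40, left associativity).
Local Notation "x ^-" := (ginv _ x) (at level 8).

Section GroupLaws.
Context {G : Group}.
Implicit Types x y z : G.

Lemma mulKg x y : x^- · (x · y) = y.
Proof. rewrite gmul_assoc, gmul_Vl; apply gmul_1l. Qed.

Lemma mulVKg x y : x · (x^- · y) = y.
Proof. rewrite gmul_assoc, gmul_Vr; apply gmul_1l. Qed.

Lemma mulgK x y : y · x · x^- = y.
Proof. rewrite <- gmul_assoc, gmul_Vr; apply gmul_1r. Qed.

Lemma mulgVK x y : y · x^- · x = y.
Proof. rewrite <- gmul_assoc, gmul_Vl; apply gmul_1r. Qed.

Lemma mulg_injl x y z : x · y = x · z -> y = z.
Proof. intros H; rewrite <- (mulKg x y), H; apply mulKg. Qed.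

Lemma mulg_injr x y z : y · x = z · x -> y = z.
Proof. intros H; rewrite <- (mulgK x y), H; apply mulgK. Qed.

Lemma invgK x : x^-^- = x.
Proof. apply (@mulg_injl x^-); rewrite gmul_Vl; apply gmul_Vr. Qed.

Lemma invg_inj x y : x^- = y^- -> x = y.
Proof. intros H; rewrite <- (invgK x), H; apply invgK. Qed.

Lemma ltransE x (A : G -> Prop) y : ltrans x A y <-> A (x^- · y).
Proof.
split.
- intros (a & Ha & ->); rewrite mulKg; trivial.
- intros H; exists (x^- · y); rewrite mulVKg; auto.
Qed.

Lemma rtransE x (A : G -> Prop) y : rtrans A x y <-> A (y · x^-).
Proof.
split.
- intros (a & Ha & ->); rewrite mulgK; trivial.
- intros H; exists (y · x^-); rewrite mulgVK; auto.
Qed.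

Lemma uf_actE x (p : (G -> Prop) -> Prop) (P : G -> Prop) :
  uf_act x p P <-> p (fun y => P (x · y)).
Proof.
split.
- intros (Q & HQ & ->).
  replace (fun y => ltrans x Q (x · y)) with Q; trivial.
  apply pred_ext; intros y; rewrite ltransE, mulKg; tauto.
- intros H; eexists; split; [exact H |].
  apply pred_ext; intros y; rewrite ltransE, mulVKg; tauto.
Qed.

End GroupLaws.

(** * Ultrafilters and the freeness of the action on them *)

Section Ultrafilters.
Context {G : Group}.
Context (p : (G -> Prop) -> Prop) (Hp : ultrafilter p).

Lemma uf_empty : ~ p (fun _ => False).
Proof. apply Hp. Qed.

Lemma uf_sub (P Q : G -> Prop) : p P -> (forall x, P x -> Q x) -> p Q.
Proof. apply Hp. Qed.

Lemma uf_and (P Q : G -> Prop) : p P -> p Q -> p (fun x => P x /\ Q x).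
Proof. apply Hp. Qed.

Lemma uf_or (P Q : G -> Prop) : p (fun x => P x \/ Q x) -> p P \/ p Q.
Proof.
intros H; destruct Hp as (_ & _ & _ & Hu).
destruct (Hu P) as [HP | HP]; auto; right.
eapply uf_sub; [exact (uf_and H HP) |]; simpl; tauto.
Qed.

Lemma uf_exists_in {T : Type} (l : list T) (P : T -> G -> Prop) :
  p (fun x => exists t, In t l /\ P t x) -> exists t, In t l /\ p (P t).
Proof.
induction l as [|a l IH]; intros H.
- destruct uf_empty; apply (uf_sub _ H); intros x (t & [] & _).
- destruct (@uf_or (P a) (fun x => exists t, In t l /\ P t x)) as [Ha | Hl].
  + apply (uf_sub _ H); intros x (t & [<- | Ht] & Hx); eauto.
  + exists a; simpl; auto.
  + destruct (IH Hl) as (t & Ht & HP); exists t; simpl; auto.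
Qed.

(* If c <> 1, a set M maximal subject to M and c^-1 M being disjoint satisfies
   G = M ∪ c M ∪ c^-1 M, and an ultrafilter fixed by c cannot contain any of
   these three sets. *)
Lemma uf_fixed_trivial (c : G) :
  (forall P, p (fun x => P (c · x)) <-> p P) -> c = gone G.
Proof.
intros Hc; apply NNPP; intros Hc1.
destruct (@maximal_predicate G (fun M => forall x, M x -> ~ M (c · x))
  (fun _ => False)) as (M & HM & Hmax).
{ auto. }
{ intros C HC _ Htot x (S & CS & Sx) (S' & CS' & Sx').
  destruct (Htot S S' CS CS') as [H | H].
  - exact (HC S' CS' x (H x Sx) Sx').
  - exact (HC S CS x Sx (H _ Sx')). }
assert (HMp : ~ p M).
{ intros H; apply uf_empty; apply (uf_sub _ (uf_and H (proj2 (Hc M) H))).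
  intros x [H1 H2]; exact (HM x H1 H2). }
(* If [x] were in none of the three sets, [M] with [x] added would still be admissible, the case
   [c · x = x] being excluded by [c <> 1]. *)
assert (Hcov : forall x, M x \/ M (c · x) \/ M (c^- · x)).
{ intros x; apply NNPP; intros Hx; apply Hx; left.
  apply (Hmax (fun y => M y \/ y = x)); auto.
  intros y [Hy | ->] [Hy' | Hy'].
  - exact (HM y Hy Hy').
  - apply Hx; right; right; rewrite <- Hy', mulKg; trivial.
  - apply Hx; auto.
  - apply Hc1, (@mulg_injr G x); rewrite gmul_1l; trivial. }
destruct (@uf_or M (fun x => M (c · x) \/ M (c^- · x))) as [H | H]; auto.
{ destruct (proj2 (proj2 (proj2 Hp)) (fun _ => True)) as [H | H];
    apply (uf_sub _ H); intros x Hx; auto; tauto. }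
apply uf_or in H; destruct H as [H | H]; apply HMp; [apply Hc, H |].
apply Hc in H; apply (uf_sub _ H); intros x; rewrite mulKg; trivial.
Qed.

(** Testing the equality on the translates [b P] shows that [b^- · a] fixes [p]. *)
Lemma uf_act_free (a b : G) : uf_act a p = uf_act b p -> a = b.
Proof.
intros H.
assert (E : b^- · a = gone G).
{ apply uf_fixed_trivial; intros P.
  assert (E := equal_f H (fun y => P (b^- · y))).
  assert (Ea := uf_actE a p (fun y => P (b^- · y))).
  assert (Eb := uf_actE b p (fun y => P (b^- · y))).
  cbv beta in Ea, Eb.
  replace (fun x => P (b^- · a · x)) with (fun x => P (b^- · (a · x)))
    by (extensionality x; rewrite gmul_assoc; trivial).
  replace (fun x => P (b^- · (b · x))) with P in Eb
    by (extensionality x; rewrite mulKg; trivial).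
  rewrite <- Ea, <- Eb, E; tauto. }
apply (@mulg_injl G b^-); rewrite E, gmul_Vl; trivial.
Qed.

End Ultrafilters.

(** * Translation-closed ideals and ultrafilters avoiding them *)

Section Ideals.
Context {G : Group}.

(** The parameter [H] covers both ordinary ideals, with [H] trivial, and left-invariant ideals, with
    [H] all of [G]. *)
Definition ideal (H : G -> Prop) (I : (G -> Prop) -> Prop) : Prop :=
  I (fun _ => False) /\
  (forall P Q, I P -> I Q -> I (fun x => P x \/ Q x)) /\
  (forall P Q : G -> Prop, I P -> (forall x, Q x -> P x) -> I Q) /\
  (forall h P, H h -> I P -> I (fun x => P (h · x))).

(** The predicate [N] of the proof is the ideal generated by [I] and [Y]. When [Y] is not in [I] it
    is strictly larger than [I], so maximality forces it to contain [X]. *)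
Lemma maximal_ideal (H : G -> Prop) (I0 : (G -> Prop) -> Prop) (X : G -> Prop) :
  H (gone G) -> (forall h k, H h -> H k -> H (h · k)) ->
  ideal H I0 -> ~ I0 X ->
  exists I, ideal H I /\ (forall P, I0 P -> I P) /\ ~ I X /\
    forall Y, ~ I Y -> exists J hs, I J /\ (forall h, In h hs -> H h) /\
      forall x, X x -> J x \/ exists h, In h hs /\ Y (h · x).
Proof.
intros H1 HM HI0 HX.
destruct (@maximal_predicate (G -> Prop)
  (fun I => ideal H I /\ (forall P, I0 P -> I P) /\ ~ I X) I0)
  as (I & (HI & HI0I & HIX) & Hmax).
{ auto. }
{ intros C HC (S0 & CS0) Htot; split; [split; [| split; [| split]] | split].
  - destruct (HC S0 CS0) as ((H0 & _) & _); exists S0; auto.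
  - assert (Hu : forall S P Q, C S -> S P -> S Q ->
      exists S, C S /\ S (fun x => P x \/ Q x)).
    { intros S P Q CS SP SQ; destruct (HC S CS) as ((_ & Hu & _) & _).
      exists S; auto. }
    intros P Q (S & CS & SP) (S' & CS' & SQ).
    destruct (Htot S S' CS CS') as [Hs | Hs]; eauto.
  - intros P Q (S & CS & SP) HQ; exists S; split; trivial.
    destruct (HC S CS) as ((_ & _ & Hd & _) & _); exact (Hd P Q SP HQ).
  - intros h P Hh (S & CS & SP); exists S; split; trivial.
    destruct (HC S CS) as ((_ & _ & _ & Ht) & _); auto.
  - intros P HP; exists S0; split; trivial.
    destruct (HC S0 CS0) as (_ & Hi & _); auto.
  - intros (S & CS & SX); destruct (HC S CS) as (_ & _ & HS); auto. }
exists I; do 3 (split; trivial); intros Y HY.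
pose (N := fun P : G -> Prop => exists J hs, I J /\ (forall h, In h hs -> H h) /\
      forall x, P x -> J x \/ exists h, In h hs /\ Y (h · x)).
change (N X); apply NNPP; intros HNX; apply HY.
destruct HI as (HI_0 & HIu & HId & HIt).
assert (HIN : forall P, I P -> N P).
{ intros P HP; exists P, []; simpl; intuition. }
apply (Hmax N); trivial.
- split; [split; [auto | split; [| split]] | split]; auto.
  + intros P Q (J & hs & HJ & Hhs & HP) (J' & hs' & HJ' & Hhs' & HQ).
    exists (fun x => J x \/ J' x), (hs ++ hs'); split; [auto | split].
    * intros h Hh; apply in_app_or in Hh; destruct Hh; auto.
    * intros x [Px | Qx]; [destruct (HP x Px) as [? | (h & Hh & ?)]
                          | destruct (HQ x Qx) as [? | (h & Hh & ?)]]; auto;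
        right; exists h; split; trivial; apply in_or_app; auto.
  + intros P Q (J & hs & HJ & Hhs & HP) HQ; exists J, hs; auto.
  + intros k P Hk (J & hs & HJ & Hhs & HP).
    exists (fun x => J (k · x)), (map (fun h => h · k) hs); split; [auto | split].
    * intros h Hh; apply in_map_iff in Hh; destruct Hh as (h' & <- & Hh'); auto.
    * intros x Px; destruct (HP _ Px) as [? | (h & Hh & HYh)]; auto.
      right; exists (h · k); split; [apply in_map_iff; eauto |].
      rewrite <- gmul_assoc; trivial.
- exists (fun _ => False), [gone G]; split; [trivial | split].
  + intros h [<- | []]; trivial.
  + intros x Yx; right; exists (gone G); split; [left; trivial |].
    rewrite gmul_1l; trivial.
Qed.

(** The ultrafilter consists of the complements of members of an ideal [M] containing [I] and
    maximal among those excluding [Y]. *)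
Lemma uf_avoiding_ideal (I : (G -> Prop) -> Prop) (Y : G -> Prop) :
  ideal (fun h => h = gone G) I -> ~ I Y ->
  exists p, ultrafilter p /\ p Y /\ forall P, I P -> ~ p P.
Proof.
intros HI HY.
destruct (@maximal_ideal (fun h => h = gone G) I Y)
  as (M & (HM0 & HMu & HMd & _) & HIM & HMY & Hmax); trivial.
{ intros h k -> ->; apply gmul_1l. }
(* Otherwise [Y] is covered modulo [M] both by [P] and by its complement, hence lies in [M]. *)
assert (Hc : forall P, ~ M P -> ~ M (fun x => ~ P x) -> False).
{ intros P H1 H2.
  destruct (Hmax _ H1) as (J & hs & HJ & Hhs & HYJ).
  destruct (Hmax _ H2) as (J' & hs' & HJ' & Hhs' & HYJ').
  apply HMY; apply (HMd _ _ (HMu _ _ HJ HJ')); intros x Yx.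
  destruct (HYJ x Yx) as [? | (h & Hh & HP)]; auto.
  destruct (HYJ' x Yx) as [? | (h' & Hh' & HP')]; auto.
  apply Hhs in Hh; apply Hhs' in Hh'; subst.
  contradiction. }
exists (fun P => M (fun x => ~ P x)); split; [split; [| split; [| split]] | split].
- intros H; apply HMY, (HMd _ _ H); auto.
- intros P Q HP HPQ; apply (HMd _ _ HP); auto.
- intros P Q HP HQ; apply (HMd _ _ (HMu _ _ HP HQ)); intros x Hx; tauto.
- intros P; apply NNPP; intros H; apply (Hc (fun x => ~ P x)); tauto.
- apply NNPP; intros H; exact (Hc Y HMY H).
- intros P HP HnP; apply HMY, (HMd _ _ (HMu _ _ (HIM P HP) HnP)).
  intros x _; apply classic.
Qed.

End Ideals.

(** * Products over increasing index sequences *)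

Lemma Sorted_rcons (s : list nat) (a : nat) :
  Sorted lt (s ++ [a]) <-> Sorted lt s /\ forall i, In i s -> i < a.
Proof.
split.
- intros H; apply Sorted_StronglySorted in H; [| exact Nat.lt_trans].
  enough (StronglySorted lt s /\ forall i, In i s -> i < a) as [H1 H2]
    by (split; [apply StronglySorted_Sorted |]; trivial).
  induction s as [|b s IH]; simpl in *; [split; [constructor | tauto] |].
  inversion H as [|? ? Hs Hb]; subst; destruct (IH Hs) as [IH1 IH2].
  rewrite Forall_app in Hb; destruct Hb as [Hb Ha]; inversion Ha; subst.
  split; [constructor; trivial |]; intros i [<- | Hi]; auto.
- intros [Hs Ha]; induction s as [|b s IH]; simpl; [repeat constructor |].
  inversion Hs as [|? ? Hs' Hb]; subst; constructor.
  + apply IH; simpl in Ha; auto.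
  + destruct s; simpl; constructor; [apply Ha; left; trivial | inversion Hb; trivial].
Qed.

Section Products.
Context {G : Group}.

Lemma gprod_app (s t : list G) : gprod (s ++ t) = gprod s · gprod t.
Proof.
induction s as [|a s IH]; simpl.
- symmetry; apply gmul_1l.
- rewrite IH; apply gmul_assoc.
Qed.

(* For [l = hist g n], these are the products g_{i_1} ... g_{i_k} with
   i_1 < ... < i_k < n, the empty product included. *)
Fixpoint prods (l : list G) : list G :=
  match l with
  | [] => [gone G]
  | t :: l => prods l ++ map (fun s => s · t) (prods l)
  end.

Lemma in_prods_S (g : nat -> G) (n : nat) (t : G) :
  In t (prods (hist g (S n))) <->
  In t (prods (hist g n)) \/ exists s, In s (prods (hist g n)) /\ t = s · g n.
Proof.
simpl; rewrite in_app_iff, in_map_iff; split; (intros [H | (s & H1 & H2)];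
  [left | right; exists s]); auto.
Qed.

Lemma prods_1 (l : list G) : In (gone G) (prods l).
Proof. induction l; simpl; auto; apply in_or_app; auto. Qed.

Lemma prods_mono (g : nat -> G) (m n : nat) (t : G) :
  m <= n -> In t (prods (hist g m)) -> In t (prods (hist g n)).
Proof.
intros Hmn Ht; induction Hmn; trivial; apply in_prods_S; auto.
Qed.

Lemma prods_single (g : nat -> G) (i n : nat) :
  i < n -> In (g i) (prods (hist g n)).
Proof.
intros Hi; apply (@prods_mono g (S i)); [lia |].
apply in_prods_S; right; exists (gone G); split; [apply prods_1 |].
rewrite gmul_1l; trivial.
Qed.

(** Taking [n = 0] separates the empty product from the elements of the FP-set. *)
Lemma prods_last (g : nat -> G) (m n : nat) (t : G) :
  In t (prods (hist g m)) ->
  In t (prods (hist g n)) \/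
  exists r s, n <= r /\ In s (prods (hist g r)) /\ t = s · g r.
Proof.
induction m as [|m IH]; intros Ht.
- left; apply (@prods_mono g 0); [lia | trivial].
- apply in_prods_S in Ht; destruct Ht as [Ht | (s & Hs & ->)]; auto.
  destruct (le_lt_dec n m) as [Hnm | Hmn].
  + right; exists m, s; auto.
  + left; apply (@prods_mono g (S m)); trivial; apply in_prods_S; eauto.
Qed.

Lemma in_prods_sorted (g : nat -> G) (n : nat) (t : G) :
  In t (prods (hist g n)) <->
  exists s, Sorted lt s /\ (forall i, In i s -> i < n) /\ t = gprod (map g s).
Proof.
split.
- revert t; induction n as [|n IH]; intros t Ht.
  + destruct Ht as [<- | []]; exists []; simpl; intuition.
  + apply in_prods_S in Ht; destruct Ht as [Ht | (t' & Ht & ->)];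
      apply IH in Ht; destruct Ht as (s & H1 & H2 & ->).
    * exists s; auto with arith.
    * exists (s ++ [n]); split; [apply Sorted_rcons; auto | split].
      -- intros i Hi; apply in_app_or in Hi.
         destruct Hi as [Hi | [<- | []]]; auto with arith.
      -- rewrite map_app, gprod_app; simpl; rewrite gmul_1r; trivial.
- intros (s & H1 & H2 & ->); revert n H1 H2.
  induction s as [|a s IH] using rev_ind; intros n H1 H2; [apply prods_1 |].
  apply Sorted_rcons in H1; destruct H1 as [H1 H3].
  apply (@prods_mono g (S a)); [apply H2, in_or_app; simpl; auto |].
  rewrite map_app, gprod_app; simpl gprod; rewrite gmul_1r.
  apply in_prods_S; eauto.
Qed.

(** Isolating the last index, the one that selects the shift, replaces sorted lists by [prods] in
    what follows. *)
Lemma PSFPset_prods (g b : nat -> G) (y : G) :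
  PSFPset g b y <->
  exists n t, In t (prods (hist g n)) /\ y = t · g n · b n.
Proof.
split.
- intros (s & Hs & Hsort & ->); destruct s as [|a s _] using rev_ind; [tauto |].
  apply Sorted_rcons in Hsort; destruct Hsort as [H1 H2].
  exists a, (gprod (map g s)); split; [apply in_prods_sorted; eauto |].
  rewrite last_last, map_app, gprod_app; simpl; rewrite gmul_1r; trivial.
- intros (n & t & Ht & ->); apply in_prods_sorted in Ht.
  destruct Ht as (s & H1 & H2 & ->); exists (s ++ [n]); split; [| split].
  + intros H; apply app_eq_nil in H; destruct H; discriminate.
  + apply Sorted_rcons; auto.
  + rewrite last_last, map_app, gprod_app; simpl; rewrite gmul_1r; trivial.
Qed.

Lemma FPset_prods (g : nat -> G) (y : G) :
  FPset g y <-> exists n t, In t (prods (hist g n)) /\ y = t · g n.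
Proof.
assert (E : FPset g y <-> PSFPset g (fun _ => gone G) y).
{ split; intros (s & H1 & H2 & ->); exists s; rewrite gmul_1r; auto. }
rewrite E, PSFPset_prods; split; intros (n & t & Ht & ->); exists n, t;
  rewrite gmul_1r; auto.
Qed.

Lemma FPset_subsequence (g : nat -> G) (phi : nat -> nat) (y : G) :
  (forall i j, i < j -> phi i < phi j) ->
  FPset (fun i => g (phi i)) y -> FPset g y.
Proof.
intros Hphi (s & H1 & H2 & ->); exists (map phi s); split; [| split].
- destruct s; simpl; congruence.
- clear H1; induction H2 as [|a s Hs IH Ha]; simpl; constructor; trivial.
  destruct Ha; simpl; constructor; auto.
- rewrite map_map; trivial.
Qed.

(** Cutting at [m] exhibits a set of products as a finite union of left translates of the products
    of the tail sequence. *)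
Lemma prods_split (g : nat -> G) (m k : nat) (t : G) :
  In t (prods (hist g (m + k))) <->
  exists s u, In s (prods (hist g m)) /\
    In u (prods (hist (fun i => g (m + i)) k)) /\ t = s · u.
Proof.
revert t; induction k as [|k IH]; intros t.
- rewrite Nat.add_0_r; split.
  + intros Ht; exists t, (gone G); rewrite gmul_1r; simpl; auto.
  + intros (s & u & Hs & [<- | []] & ->); rewrite gmul_1r; trivial.
- rewrite Nat.add_succ_r, in_prods_S, IH; split.
  + intros [(s & u & Hs & Hu & ->) | (t' & Ht & ->)].
    * exists s, u; split; [| split]; trivial; apply in_prods_S; auto.
    * apply IH in Ht; destruct Ht as (s & u & Hs & Hu & ->).
      exists s, (u · g (m + k)); split; [| split]; trivial.
      -- apply in_prods_S; eauto.
      -- symmetry; apply gmul_assoc.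
  + intros (s & u & Hs & Hu & ->); apply in_prods_S in Hu.
    destruct Hu as [Hu | (v & Hv & ->)]; [left; eauto |].
    right; exists (s · v); split; [apply IH; eauto | apply gmul_assoc].
Qed.

End Products.

(** * Sets that are not thin or not sparse *)

Section Characterizations.
Context {G : Group}.
Implicit Type A : G -> Prop.

(** A point [y] is in [g A] exactly when [g^- · y] is in [A], so [F] corresponds to the inverses of
    the [g i] and [x] enumerates points of their infinite intersection. *)
Lemma not_n_thinP A (n : nat) :
  ~ n_thin n A <->
  exists (F : list G) (x : nat -> G),
    NoDup F /\ length F = S n /\ injective_seq x /\
    (forall k f, In f F -> A (f · x k)).
Proof.
split.
- intros H; apply not_all_ex_not in H; destruct H as [g H].
  apply imply_to_and in H; destruct H as [Hg Hf].
  destruct (injective_choice (fun _ => _) (fun _ => Hf)) as (x & Hx & HR).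
  exists (map (fun i => (g i)^-) (seq 0 (S n))), x.
  split; [| split; [| split]]; trivial.
  + apply NoDup_map_NoDup_ForallPairs; [| apply seq_NoDup].
    intros i j Hi Hj Hij; apply in_seq in Hi; apply in_seq in Hj.
    apply Hg; [lia.. |]; apply invg_inj, Hij.
  + rewrite length_map; apply length_seq.
  + intros k f Hf'; apply in_map_iff in Hf'; destruct Hf' as (i & <- & Hi).
    apply in_seq in Hi; apply ltransE, HR; lia.
- intros (F & x & HF & HFn & Hx & HA) H.
  refine (@infinite_of_tail _ _ x 0 Hx _
           (H (fun i => (nth i F (gone G))^-) _)).
  + intros k _ i Hi; apply ltransE; rewrite invgK.
    apply HA, nth_In; lia.
  + intros i j Hi Hj Hij; apply invg_inj in Hij.
    apply (NoDup_nth F (gone G)); trivial; lia.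
Qed.

Lemma not_sparseP A :
  ~ sparse A <->
  exists x y : nat -> G, injective_seq x /\ injective_seq y /\
    (forall n m, n <= m -> A (x n · y m)).
Proof.
split.
- intros H; apply not_all_ex_not in H; destruct H as [X H].
  apply imply_to_and in H; destruct H as [HX HF].
  destruct (injective_choice (fun _ => X) (fun _ => HX)) as (x & Hx & HxX).
  (* [hist x (S m)] includes the index [m] itself, since [n <= m] is not strict. *)
  destruct (@injective_choice G
    (fun m y => forall f, In f (hist x (S m)) -> ltrans f A y)) as (y & Hy & Hxy).
  { intros m Hm; apply HF; exists (hist x (S m)); split; trivial.
    intros f Hf; apply in_hist in Hf; destruct Hf as (i & _ & ->); trivial. }
  exists (fun n => (x n)^-), y; split; [| split]; trivial.
  + intros i j Hij; apply Hx, invg_inj, Hij.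
  + intros n m Hnm; apply ltransE, Hxy, in_hist; exists n; split; trivial; lia.
- intros (x & y & Hx & Hy & HA) H.
  destruct (H (fun z => exists n, z = (x n)^-)) as (F & HF & Hfin).
  { apply (@infinite_of_tail _ _ (fun n => (x n)^-) 0); [| eauto].
    intros i j Hij; apply Hx, invg_inj, Hij. }
  (* [F] involves only finitely many of the [x n], so all but finitely many [y m] lie in the
     intersection. *)
  assert (HN : exists N, forall m, N <= m -> forall f, In f F -> ltrans f A (y m)).
  { clear Hfin; induction F as [|f F IH]; [exists 0; intros m _ f [] |].
    destruct IH as [N HN]; [intros; apply HF; right; trivial |].
    destruct (HF f) as [n ->]; [left; trivial |].
    exists (N + n); intros m Hm f [<- | Hf].
    - apply ltransE; rewrite invgK; apply HA; lia.
    - apply HN; trivial; lia. }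
  destruct HN as [N HN]; revert Hfin; exact (infinite_of_tail Hy HN).
Qed.

(** * Recurrent subsets and FP-sets *)

Lemma recurrentE (B : G -> Prop) :
  recurrent B <->
  forall K : list G, ~ finite (fun h => forall k, In k K -> (B (k · h) <-> B k)).
Proof.
split.
- intros H K Hf.
  apply (H (fun C => forall k, In k K -> (C k <-> B k))); [exists K; auto |].
  (* [k] is in [B h^-] exactly when [k · h] is in [B]; hence the inversion. *)
  apply (finite_image (ginv G) _ Hf); intros h Hh; exists h^-.
  rewrite invgK; split; trivial.
  intros k Hk; rewrite <- (Hh k Hk), rtransE; tauto.
- intros H U [K HK] Hf; apply (H K).
  apply (finite_image (ginv G) _ Hf); intros h Hh; exists h^-.
  rewrite invgK; split; trivial.
  apply HK; intros k Hk; rewrite <- (Hh k Hk), rtransE, invgK; tauto.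
Qed.

(** The finite set [x · prods l] is kept inside [B]. Recurrence gives infinitely many [h] whose
    right translation keeps it there, and a new one extends [l]. *)
Lemma recurrent_contains_FP A (B : G -> Prop) (x : G) :
  (forall b, B b -> A b) -> B x -> recurrent B ->
  exists g : nat -> G, injective_seq g /\ forall y, FPset g y -> A (x · y).
Proof.
intros HBA Bx HB; rewrite recurrentE in HB.
destruct (@dependent_choice_inv G (fun l => forall t, In t (prods l) -> B (x · t)))
  as (g & Hg & Hinv).
- intros t [<- | []]; rewrite gmul_1r; trivial.
- intros l Hl.
  destruct (infinite_not_in l (HB (map (gmul G x) (prods l)))) as (h & Hh & Hhl).
  exists h; split; trivial; intros t Ht; simpl in Ht; apply in_app_or in Ht.
  destruct Ht as [Ht | Ht]; auto.
  apply in_map_iff in Ht; destruct Ht as (s & <- & Hs).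
  rewrite gmul_assoc; apply Hh; auto; apply in_map; trivial.
- exists g; split; trivial; intros y Hy; apply FPset_prods in Hy.
  destruct Hy as (n & t & Ht & ->).
  apply HBA, (Hinv (S n)), in_prods_S; eauto.
Qed.

(* Along a sequence [h] with [h n] outside [collisions x (hist h n)], the set
   [B = {x} ∪ x FP(h)] satisfies [k · h n ∈ B -> k ∈ B] for every [k] and all
   large [n]. A point [k] outside [B] that some [h j] sends into [B] has the
   form [s' · (h j)^-]; the two families below rule out [k · h n = s] and
   [k · h n = s · h m] with [m > n] respectively. *)
Definition collisions (x : G) (l : list G) : list G :=
  let S := map (gmul G x) (prods l) in
  map (fun '(j, (s', s)) => j · s'^- · s) (list_prod l (list_prod S S)) ++
  map (fun '(j, (s', s), h) => s^- · (s' · j^- · h))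
    (list_prod (list_prod l (list_prod S S)) l).

Lemma collisions_hit (x : G) (l : list G) (j s s' : G) :
  In j l -> In s (prods l) -> In s' (prods l) ->
  In (j · (x · s')^- · (x · s)) (collisions x l).
Proof.
intros Hj Hs Hs'; apply in_or_app; left; apply in_map_iff.
exists (j, (x · s', x · s)); split; trivial.
repeat (apply in_prod; [try apply in_map; trivial |]); apply in_map; trivial.
Qed.

Lemma collisions_later (x : G) (l : list G) (j s s' h : G) :
  In j l -> In s (prods l) -> In s' (prods l) -> In h l ->
  In ((x · s)^- · (x · s' · j^- · h)) (collisions x l).
Proof.
intros Hj Hs Hs' Hh; apply in_or_app; right; apply in_map_iff.
exists (j, (x · s', x · s), h); split; trivial.
repeat apply in_prod; trivial; apply in_map; trivial.
Qed.

(** Each stage forbids finitely many values, while every tail of an injective sequence takes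
    infinitely many. *)
Lemma avoiding_subsequence (g : nat -> G) (bad : list G -> list G) :
  injective_seq g ->
  exists phi : nat -> nat, (forall i j, i < j -> phi i < phi j) /\
    forall n, ~ In (g (phi n)) (bad (hist (fun i => g (phi i)) n)).
Proof.
intros Hg.
destruct (@dependent_choice nat (fun l i =>
  (forall j, In j l -> j < i) /\ ~ In (g i) (bad (map g l)))) as [phi Hphi].
- intros l.
  assert (Hfin : ~ finite (fun z => exists i, z = g i /\ forall j, In j l -> j < i)).
  { assert (HN : exists N, forall j, In j l -> j < N).
    { induction l as [|a l [N HN]]; [exists 0; intros j [] |].
      exists (S a + N); intros j [<- | Hj]; [lia |]; apply HN in Hj; lia. }
    destruct HN as [N HN]; apply (@infinite_of_tail _ _ g N); trivial.
    intros n Hn; exists n; split; trivial; intros j Hj; apply HN in Hj; lia. }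
  destruct (infinite_not_in (bad (map g l)) Hfin) as (z & (i & -> & Hi) & Hz).
  exists i; auto.
- exists phi; split.
  + intros i j Hij; apply (proj1 (Hphi j)), in_hist; eauto.
  + intros n; rewrite <- map_hist; apply Hphi.
Qed.

Lemma FP_contains_recurrent (x : G) (g : nat -> G) :
  injective_seq g ->
  exists B : G -> Prop,
    B x /\ recurrent B /\ forall b, B b -> b = x \/ exists y, FPset g y /\ b = x · y.
Proof.
intros Hg.
destruct (avoiding_subsequence (collisions x) Hg) as (phi & Hphi & Hbad).
set (h := fun i => g (phi i)) in Hbad.
assert (Hh : injective_seq h).
{ intros i j Hij; apply Hg in Hij.
  destruct (lt_eq_lt_dec i j) as [[Hl | He] | Hl]; trivial;
    apply Hphi in Hl; lia. }
pose (B := fun b => exists n t, In t (prods (hist h n)) /\ b = x · t).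
exists B; split; [| split].
- exists 0, (gone G); rewrite gmul_1r; simpl; auto.
(* Single points suffice: for a finite [K] the thresholds are added up. *)
- assert (Hk : forall k, exists N, forall n, N <= n -> (B (k · h n) <-> B k)).
  { intros k; destruct (classic (B k)) as [Bk | nBk].
    - destruct Bk as (N & t & Ht & ->); exists N; intros n Hn; split; intros _.
      + exists N, t; auto.
      + exists (S n), (t · h n); rewrite in_prods_S, gmul_assoc; split; trivial.
        right; exists t; split; trivial; apply (prods_mono h t Hn); trivial.
    - destruct (classic (exists j, B (k · h j))) as [(j & M & s' & Hs' & Ek) | Hno].
      + assert (Ek' : k = x · s' · (h j)^-) by (rewrite <- Ek, mulgK; trivial).
        (* From here on [h j] and [s'] are built from terms before [n], hence available to
           [collisions]. *)
        exists (S j + M); intros n Hn; split; [| tauto].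
        intros (r & t & Ht & E); exfalso.
        assert (Hj : forall m, n <= m -> In (h j) (hist h m)).
        { intros m Hm; apply in_hist; exists j; split; trivial; lia. }
        assert (HM : forall m, n <= m -> In s' (prods (hist h m))).
        { intros m Hm; apply (@prods_mono _ h M); trivial; lia. }
        (* The last index of [t] is below, equal to or above [n]. The first case makes [h n] a
           collision, the second puts [k] in [B], the third makes [h m] a collision. *)
        destruct (prods_last h r n t Ht) as [Hn' | (m & s & Hm & Hs & ->)].
        * apply (Hbad n).
          replace (g (phi n)) with (h j · (x · s')^- · (x · t)).
          { apply collisions_hit; auto. }
          rewrite <- E, <- Ek, <- gmul_assoc.
          apply (@mulg_injl _ (h j)^-); rewrite mulKg.
          apply (@mulg_injl _ (k · h j)); rewrite mulVKg.
          rewrite gmul_assoc, mulgK; trivial.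
        * rewrite gmul_assoc in E.
          destruct (Nat.eq_dec n m) as [<- | Hne].
          -- apply nBk; exists n, s; split; trivial.
             exact (mulg_injr _ _ _ E).
          -- apply (Hbad m).
             replace (g (phi m)) with ((x · s)^- · (x · s' · (h j)^- · h n)).
             { apply collisions_later; auto; apply in_hist; exists n.
               split; trivial; lia. }
             rewrite <- Ek', E, mulKg; trivial.
      + exists 0; intros n _; split; intros H; [destruct Hno; eauto | tauto]. }
  apply recurrentE; intros K.
  assert (HK : exists N, forall n, N <= n ->
    forall k, In k K -> (B (k · h n) <-> B k)).
  { induction K as [|k K [N HN]]; [exists 0; intros n _ k [] |].
    destruct (Hk k) as [N' HN']; exists (N + N').
    intros n Hn k' [<- | Hk']; [apply HN' | apply HN; trivial]; lia. }
  destruct HK as [N HN]; exact (infinite_of_tail Hh HN).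
- intros b (n & t & Ht & ->).
  destruct (prods_last h n 0 t Ht) as [[<- | []] | (r & s & _ & Hs & ->)].
  + left; apply gmul_1r.
  + right; exists (s · h r); split; trivial.
    apply (FPset_subsequence g phi Hphi), FPset_prods; eauto.
Qed.

(** [B] must be nonempty: in an infinite group the empty set is recurrent and lies in every [A]. *)
Lemma recurrent_subsetP A :
  (exists B : G -> Prop, (forall b, B b -> A b) /\ (exists b, B b) /\ recurrent B) <->
  (exists x, A x /\ exists g : nat -> G, injective_seq g /\
     (forall y, FPset g y -> A (x · y))).
Proof.
split.
- intros (B & HBA & (x & Bx) & HB); exists x; split; auto.
  exact (@recurrent_contains_FP A B x HBA Bx HB).
- intros (x & Ax & g & Hg & HA).
  destruct (FP_contains_recurrent x Hg) as (B & Bx & HB & HBx).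
  exists B; split; [| eauto].
  intros b Hb; destruct (HBx b Hb) as [-> | (y & Hy & ->)]; auto.
Qed.

(** * Piecewise shifted FP-sets and scattered sets *)

Lemma PSFPset_not_scattered A (g b : nat -> G) :
  injective_seq g -> (forall y, PSFPset g b y -> A y) -> ~ scattered A.
Proof.
intros Hg HA Hsc.
destruct (Hsc (PSFPset g b)) as (p & Hp & Hfree & HX & HD); trivial.
{ apply infinite_of_arbitrarily_many; intros N.
  (* As [b] is arbitrary, elements with different last indices may coincide; fixing the last index
     at [N] leaves [N] distinct ones. *)
  exists (fun i => g i · g N · b N); split.
  - intros i j _ _ Hij; apply mulg_injr, mulg_injr, Hg in Hij; trivial.
  - intros i Hi; apply PSFPset_prods; exists N, (g i); split; trivial.
    apply prods_single, Hi. }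
revert HD; apply infinite_of_arbitrarily_many; intros m.
pose (X' := PSFPset (fun i => g (m + i)) (fun i => b (m + i))).
assert (HX' : forall t u, In t (prods (hist g m)) -> X' u -> PSFPset g b (t · u)).
{ intros t u Ht Hu; apply PSFPset_prods in Hu; destruct Hu as (n & v & Hv & ->).
  apply PSFPset_prods; exists (m + n), (t · v); split; [apply prods_split; eauto |].
  rewrite !gmul_assoc; trivial. }
assert (Hs : exists s, In s (prods (hist g m)) /\ p (fun x => X' (s^- · x))).
{ apply uf_exists_in; trivial.
  (* [E] holds the elements with last index below [m]. It is finite, so the free [p] contains the
     union of the translates [s X']. *)
  pose (E := fun x => exists n t, n < m /\ In t (prods (hist g n)) /\ x = t · g n · b n).
  assert (HE : finite E).
  { clear; unfold E; induction m as [|m IH].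
    - exists []; intros x (n & t & Hn & _); lia.
    - destruct IH as [l Hl].
      exists (map (fun t => t · g m · b m) (prods (hist g m)) ++ l).
      intros x (n & t & Hn & Ht & ->); apply in_or_app.
      destruct (Nat.eq_dec n m) as [-> | Hne]; [left | right].
      + apply in_map_iff; eauto.
      + apply Hl; exists n, t; split; [lia | auto]. }
  destruct (@uf_or _ p Hp E
    (fun x => exists s, In s (prods (hist g m)) /\ X' (s^- · x))) as [H | H]; trivial.
  - apply (uf_sub Hp _ _ HX); intros x Hx; apply PSFPset_prods in Hx.
    destruct Hx as (n & t & Ht & ->).
    destruct (le_lt_dec m n) as [Hmn | Hnm]; [right | left; exists n, t; auto].
    replace n with (m + (n - m)) in * by lia.
    apply prods_split in Ht; destruct Ht as (s & u & Hs & Hu & ->).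
    exists s; split; trivial; rewrite <- !gmul_assoc, mulKg.
    apply PSFPset_prods; exists (n - m), u; rewrite gmul_assoc; auto.
  - destruct (Hfree E H HE). }
destruct Hs as (s & _ & Hs).
(* [g i · s^-] carries [s X'] onto [g i X'], which lies in the piecewise shifted FP-set. *)
exists (fun i => uf_act (g i · s^-) p); split.
- intros i j _ _ Hij; apply (uf_act_free Hp), mulg_injr, Hg in Hij; trivial.
- intros i Hi; exists (g i · s^-); split; trivial; apply uf_actE.
  apply (uf_sub Hp _ _ Hs); intros x Hx; rewrite <- gmul_assoc.
  apply HX'; trivial; apply prods_single, Hi.
Qed.

Lemma ideal_finite : ideal (fun _ : G => True) finite.
Proof.
split; [| split; [| split]].
- exists []; tauto.
- exact (@finite_union G).
- intros P Q HP HQ; exact (finite_subset _ HQ HP).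
- intros h P _ HP; apply (finite_image (gmul G h^-) _ HP).
  intros y Hy; exists (h · y); rewrite mulKg; auto.
Qed.

(* By maximality X is covered, modulo I, by finitely many translates of Y.
   If p contains Y and avoids I, then each of the infinitely many translates
   g p containing X contains a translate h^-1 Y with h in that finite list,
   so Y ∩ (h g)^-1 Y is in p. *)
Lemma ideal_return (I : (G -> Prop) -> Prop) (X Y : G -> Prop) (l : list G) :
  ideal (fun _ => True) I -> (forall P, finite P -> I P) ->
  (forall p, ultrafilter p -> free_uf p -> p X -> ~ finite (Delta p X)) ->
  (exists J hs, I J /\ forall x, X x -> J x \/ exists h, In h hs /\ Y (h · x)) ->
  (forall y, Y y -> X y) -> ~ I Y ->
  exists g, ~ In g l /\ ~ I (fun x => Y x /\ Y (g · x)).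
Proof.
intros (HI0 & HIu & HId & HIt) HIfin HX (J & hs & HJ & HXJ) HYX HY.
apply NNPP; intros Hno.
destruct (@uf_avoiding_ideal G I Y) as (p & Hp & HpY & HpI); trivial.
{ split; [| split; [| split]]; auto. }
assert (HpX : p X) by (exact (uf_sub Hp _ _ HpY HYX)).
apply (HX p Hp); trivial; [intros P HP HPf; exact (HpI P (HIfin P HPf) HP) |].
(* If every suitable element were in [l], then [h · g] would be some [k] in [l], so
   [g = h^- · k]. *)
exists (map (fun '(h, k) => uf_act (h^- · k) p) (list_prod hs l)).
intros q (g & -> & Hg); apply uf_actE in Hg.
assert (H : p (fun x => exists h, In h hs /\ Y (h · (g · x)))).
{ destruct (@uf_or G p Hp (fun x => J (g · x))
    (fun x => exists h, In h hs /\ Y (h · (g · x)))) as [H | H]; trivial.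
  - apply (uf_sub Hp _ _ Hg); auto.
  - destruct (HpI _ (HIt g J Logic.I HJ) H). }
apply (uf_exists_in Hp) in H; destruct H as (h & Hh & H).
apply in_map_iff; exists (h, h · g); rewrite mulKg; split; trivial.
apply in_prod; trivial; apply NNPP; intros Hl; apply Hno.
exists (h · g); split; trivial; intros HI; apply (HpI _ HI).
apply (uf_sub Hp _ _ (uf_and Hp _ _ HpY H)); intros x; rewrite gmul_assoc; trivial.
Qed.

(** This is the intersection of the [t^- X] over [t] in [prods l]; the newest [g] acts on the point
    first and so becomes the rightmost factor of [t]. *)
Fixpoint returns (X : G -> Prop) (l : list G) : G -> Prop :=
  match l with
  | [] => X
  | g :: l => fun x => returns X l x /\ returns X l (g · x)
  end.

Lemma returns_prods (X : G -> Prop) (l : list G) (x t : G) :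
  returns X l x -> In t (prods l) -> X (t · x).
Proof.
revert x t; induction l as [|g l IH]; simpl; intros x t Hx Ht.
- destruct Ht as [<- | []]; rewrite gmul_1l; trivial.
- destruct Hx as [Hx Hgx]; apply in_app_or in Ht; destruct Ht as [Ht | Ht]; auto.
  apply in_map_iff in Ht; destruct Ht as (s & <- & Hs).
  rewrite <- gmul_assoc; auto.
Qed.

Lemma not_scattered_PSFPset A :
  ~ scattered A ->
  exists g b : nat -> G, injective_seq g /\ forall y, PSFPset g b y -> A y.
Proof.
intros H; apply not_all_ex_not in H; destruct H as [X H].
apply imply_to_and in H; destruct H as [HXA H].
apply imply_to_and in H; destruct H as [HXinf HX].
destruct (@maximal_ideal G (fun _ => True) finite X)
  as (I & HI & HIfin & HIX & Hmax); trivial.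
{ exact ideal_finite. }
(* Staying outside [I], not just nonempty, is what lets [ideal_return] supply the next term. *)
destruct (@dependent_choice_inv G (fun l => ~ I (returns X l)))
  as (g & Hg & Hinv); trivial.
{ intros l Hl; apply ideal_return with (X := X); trivial.
  - intros p Hp Hf HpX HD; apply HX; exists p; auto.
  - destruct (Hmax _ Hl) as (J & hs & HJ & _ & HXJ); eauto.
  - intros y Hy; rewrite <- (gmul_1l G y); apply (returns_prods _ _ _ _ Hy), prods_1. }
assert (Hc : forall n, exists c, returns X (hist g n) c).
{ intros n; apply NNPP; intros He; apply (Hinv n), HIfin; exists [].
  intros c Hc; apply He; eauto. }
pose (c := fun n => proj1_sig (constructive_indefinite_description _ (Hc n))).
assert (Hcn : forall n, returns X (hist g n) (c n))
  by (intros n; exact (proj2_sig (constructive_indefinite_description _ (Hc n)))).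
(* [c n] handles the products of indices below [n], and [(g n)^-] cancels the last factor [g n]. *)
exists g, (fun n => (g n)^- · c n); split; trivial.
intros y Hy; apply PSFPset_prods in Hy; destruct Hy as (n & t & Ht & ->).
rewrite <- gmul_assoc, mulVKg; apply HXA, (returns_prods _ _ _ _ (Hcn n) Ht).
Qed.

End Characterizations.

Theorem theorem4p3 (G : Group) (Hinf : ~ finite (fun _ : G => True))
  (A : G -> Prop) :
  (forall n : nat,
     ~ n_thin n A <->
     exists (F : list G) (x : nat -> G),
       NoDup F /\ length F = S n /\ injective_seq x /\
       (forall k f, In f F -> A (gmul G f (x k)))) /\
  (~ sparse A <->
     exists x y : nat -> G, injective_seq x /\ injective_seq y /\
       (forall n m, n <= m -> A (gmul G (x n) (y m)))) /\
  (~ scattered A <->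
     exists g b : nat -> G, injective_seq g /\
       (forall y, PSFPset g b y -> A y)) /\
  ((exists B : G -> Prop, (forall b, B b -> A b) /\ (exists b, B b) /\
      recurrent B) <->
   (exists x, A x /\ exists g : nat -> G, injective_seq g /\
      (forall y, FPset g y -> A (gmul G x y)))).
Proof.
split; [exact (not_n_thinP A) | split; [exact (not_sparseP A) | split]].
- split; [apply not_scattered_PSFPset |].
  intros (g & b & Hg & HA); exact (PSFPset_not_scattered Hg HA).
- exact (recurrent_subsetP A).
Qed.
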